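(* Let $(V,\mathcal{Y},c)$ be a vertex coalgebra and let $D^*=\mathrm{Res}_x\, x^{-2}(Id_V\otimes c)\mathcal{Y}(x):V\to V$. Then $$\frac{d}{dx}\mathcal{Y}(x)=\mathcal{Y}(x)D^*-(Id_V\otimes D^* )\mathcal{Y}(x).$$
   Context: All vector spaces are over a field $\mathbb{F}$ of characteristic $0$, and $x,x_0,x_1,x_2$ are commuting formal variables. $\delta(x)=\sum_{n\in\mathbb{Z}}x^n$. For $n\in\mathbb{Z}$, $(x_i\pm x_j)^n$ is expanded in nonnegative integral powers of the second listed variable $x_j$ (this also applies inside $\delta$). $\mathrm{Res}_x$ denotes the coefficient of $x^{-1}$. For a vector space $W$, $W[[x,x^{-1}]]$ is the space of all doubly infinite formal series, and $W((x^{-1}))$ is the space of formal series with only finitely many positive powers of $x$. $T:V\otimes V\to V\otimes V$ is the transposition $T(u\otimes v)=v\otimes u$. Linear maps act on formal series coefficientwise. A vertex coalgebra $(V,\mathcal{Y},c)$ is a vector space $V$ with linear maps $\mathcal{Y}(x):V\to(V\otimes V)[[x,x^{-1}]]$ (coproduct) and $c:V\to\mathbb{F}$ (covacuum map) such that for all $v\in V$: 1. Left counit: $(c\otimes Id_V)\mathcal{Y}(x)v=v$. 2. Cocreation: $(Id_V\otimes c)\mathcal{Y}(x)v\in V[[x]]$ and $\lim_{x\to0}(Id_V\otimes c)\mathcal{Y}(x)v=v$. 3. Truncation: $\mathcal{Y}(x)v\in(V\otimes V)((x^{-1}))$. 4. Jacobi identity: $$x_0^{-1}\delta\left(\tfrac{x_1-x_2}{x_0}\right)(Id_V\otimes\mathcal{Y}(x_2))\mathcal{Y}(x_1)-x_0^{-1}\delta\left(\tfrac{x_2-x_1}{-x_0}\right)(T\otimes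 Id_V)(Id_V\otimes\mathcal{Y}(x_1))\mathcal{Y}(x_2)=x_2^{-1}\delta\left(\tfrac{x_1-x_0}{x_2}\right)(\mathcal{Y}(x_0)\otimes Id_V)\mathcal{Y}(x_2).$$ *)

(* Defs.v *)
From HB Require Import structures.
From mathcomp Require Import all_boot all_order all_algebra.
From mathcomp Require Import sesquilinear freeg.
From mathcomp Require Import boolp classical_sets functions cardinality fsbigop.
From mathcomp Require Import zify.

Set Implicit Arguments.
Unset Strict Implicit.
Unset Printing Implicit Defensive.

Import Order.TTheory GRing.Theory Num.Theory.
Local Open Scope classical_set_scope.
Local Open Scope ring_scope.
Local Open Scope quotient_scope.

(* [U ⊗ W] is the quotient of the free vector space on [U * W] by the span of
   the bilinearity relations. *)

Inductive tensor_rel (F : fieldType) (U W : lmodType F) :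
    {freeg (U * W)%type / F} -> Prop :=
  | TRel0 : tensor_rel 0
  | TRelP a D E : tensor_rel D -> tensor_rel E -> tensor_rel (a *: D + E)
  | TRelDl u u' w : tensor_rel (<<(u + u', w)>> - <<(u, w)>> - <<(u', w)>>)
  | TRelDr u w w' : tensor_rel (<<(u, w + w')>> - <<(u, w)>> - <<(u, w')>>)
  | TRelZl a u w : tensor_rel (<<(a *: u, w)>> - a *: <<(u, w)>>)
  | TRelZr a u w : tensor_rel (<<(u, a *: w)>> - a *: <<(u, w)>>).

Definition tensor_ker (F : fieldType) (U W : lmodType F) :
  pred {freeg (U * W)%type / F} := fun D => `[< tensor_rel D >].

Section TensorKer.
Variables (F : fieldType) (U W : lmodType F).

Lemma tensor_kerP a D E :
  tensor_ker D -> tensor_ker E -> tensor_ker (a *: D + E : {freeg (U * W) / F}).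
Proof. by move=> /asboolP hD /asboolP hE; apply/asboolP; apply: TRelP. Qed.

Lemma tensor_ker0 : tensor_ker (0 : {freeg (U * W) / F}).
Proof. by apply/asboolP; apply: TRel0. Qed.

Lemma tensor_ker_zmod_closed : zmod_closed (@tensor_ker F U W).
Proof.
split; first exact: tensor_ker0.
by move=> D E hD hE; rewrite addrC -scaleN1r; apply: tensor_kerP.
Qed.

Lemma tensor_kerZ a D : tensor_ker D -> tensor_ker (a *: D : {freeg (U * W) / F}).
Proof. by move=> hD; rewrite -[a *: D]addr0; apply: tensor_kerP tensor_ker0. Qed.

End TensorKer.

HB.instance Definition _ (F : fieldType) (U W : lmodType F) :=
  GRing.isZmodClosed.Build {freeg (U * W)%type / F} (@tensor_ker F U W)
    (tensor_ker_zmod_closed U W).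

Definition tensor (F : fieldType) (U W : lmodType F) : Type :=
  {ideal_quot (GRing.ZmodClosed.clone {freeg (U * W)%type / F} (@tensor_ker F U W) _)}.

Notation "U ⊗ W" := (tensor U W) (at level 40, left associativity) : type_scope.

Section Tensor.
Variables (F : fieldType) (U W : lmodType F).
Notation FUW := {freeg (U * W)%type / F}.

HB.instance Definition _ := GRing.Zmodule.on (U ⊗ W).
HB.instance Definition _ := EqQuotient.on (U ⊗ W).

Definition tpi (D : FUW) : U ⊗ W := \pi D.

Fact tpi_is_zmod_morphism : zmod_morphism tpi.
Proof. by move=> D E; rewrite /tpi raddfB. Qed.
HB.instance Definition _ :=
  GRing.isZmodMorphism.Build FUW (U ⊗ W) tpi tpi_is_zmod_morphism.

Lemma tpi_eq0 D : tensor_rel D -> tpi D = 0.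
Proof.
move=> hD; rewrite -(raddf0 tpi); apply/eqP; rewrite /tpi.
by rewrite -Quotient.idealrBE subr0; apply/asboolP.
Qed.

Lemma tpi_ker D : tpi D = 0 -> tensor_rel D.
Proof.
move=> /eqP; rewrite -(raddf0 tpi) /tpi -Quotient.idealrBE subr0.
by move/asboolP.
Qed.

Lemma tpi_repr x : tpi (repr x) = x.
Proof. exact: reprK. Qed.

Lemma repr_tpi D : tensor_rel (repr (tpi D) - D).
Proof. by apply: tpi_ker; rewrite raddfB /= tpi_repr subrr. Qed.

Definition tscale (a : F) (x : U ⊗ W) : U ⊗ W := tpi (a *: repr x).

Lemma tpiZ a D : tpi (a *: D) = tscale a (tpi D).
Proof.
apply/esym/eqP; rewrite -subr_eq0 /tscale -raddfB /= -scalerBr; apply/eqP.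
apply: tpi_eq0; rewrite -[_ *: _]addr0; apply: TRelP (TRel0 _ _).
exact: repr_tpi.
Qed.

Fact tscaleA a b x : tscale a (tscale b x) = tscale (a * b) x.
Proof. by rewrite -[x]tpi_repr -!tpiZ scalerA. Qed.
Fact tscale1 : left_id 1 tscale.
Proof. by move=> x; rewrite -[x]tpi_repr -!tpiZ scale1r. Qed.
Fact tscaleDr : right_distributive tscale +%R.
Proof.
move=> a x y; rewrite -[x]tpi_repr -[y]tpi_repr -raddfD -!tpiZ.
by rewrite scalerDr raddfD.
Qed.
Fact tscaleDl x : {morph tscale^~ x : a b / a + b}.
Proof. by move=> a b; rewrite -[x]tpi_repr -!tpiZ scalerDl raddfD. Qed.

HB.instance Definition _ := GRing.Zmodule_isLmodule.Build F (U ⊗ W)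
  tscaleA tscale1 tscaleDr tscaleDl.

HB.instance Definition _ :=
  GRing.isScalable.Build F FUW (U ⊗ W) *:%R tpi tpiZ.

Definition tens (u : U) (w : W) : U ⊗ W := tpi <<(u, w)>>.

Fact tens_is_bilinear : bilinear_for *:%R *:%R tens.
Proof.
split=> [w a u v|u a w w'] /=.
  have /tpi_eq0/eqP := TRelDl (a *: u) v w.
  rewrite !raddfB /= -addrA -opprD subr_eq0 => /eqP; rewrite -/(tens _ _) => ->.
  congr (_ + _); apply/eqP.
  by rewrite -subr_eq0 -linearZ -raddfB /= tpi_eq0 //; apply: TRelZl.
have /tpi_eq0/eqP := TRelDr u (a *: w) w'.
rewrite !raddfB /= -addrA -opprD subr_eq0 => /eqP; rewrite -/(tens _ _) => ->.
congr (_ + _); apply/eqP.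
by rewrite -subr_eq0 -linearZ -raddfB /= tpi_eq0 //; apply: TRelZr.
Qed.

End Tensor.

HB.instance Definition _ (F : fieldType) (U W : lmodType F) :=
  bilinear_isBilinear.Build F U W (U ⊗ W) *:%R *:%R (@tens F U W)
    (tens_is_bilinear U W).

Notation "u ⊗ₜ w" := (tens u w) (at level 40, left associativity) : ring_scope.

Section Lift.
Variables (F : fieldType) (U W M : lmodType F).
Notation FUW := {freeg (U * W)%type / F}.

Lemma tens_ind (P : U ⊗ W -> Prop) :
  P 0 -> (forall u w x, P x -> P (u ⊗ₜ w + x)) -> forall x, P x.
Proof.
move=> P0 PD x; rewrite -[x]tpi_repr; move: (repr x) => D.
rewrite -[D]freeg_sumE raddf_sum /=.
elim: (dom D) => [|[u w] s IHs]; first by rewrite big_nil.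
rewrite big_cons /=; set a := coeff _ _.
suff -> : tpi << a *g (u, w)>> = (a *: u) ⊗ₜ w by apply: PD.
rewrite linearZl_LR /= -linearZ /=; congr tpi.
by apply/eqP/freeg_eqP => z; rewrite coeffZ !coeffU mul1r.
Qed.

Lemma eq_tens_linear (f g : {linear U ⊗ W -> M}) :
  (forall u w, f (u ⊗ₜ w) = g (u ⊗ₜ w)) -> f =1 g.
Proof.
move=> fg; apply: tens_ind => [|u w x fgx]; first by rewrite !raddf0.
by rewrite !raddfD /= fg fgx.
Qed.

Variable f : {bilinear U -> W -> M}.

Let f' (p : U * W) := f p.1 p.2.

Definition tlift (x : U ⊗ W) : M := fglift f' (repr x).

Let fgliftB : {morph fglift f' : D E / D - E}.
Proof. exact: lift_is_additive. Qed.

Let fgliftU p : fglift f' <<p>> = f' p.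
Proof. by rewrite liftU scale1r. Qed.

Let fglift0 : fglift f' 0 = 0.
Proof. by rewrite -(subr0 0) fgliftB subrr. Qed.

Let fgliftD : {morph fglift f' : D E / D + E}.
Proof.
by move=> D E; rewrite -[D in RHS](addrK E) fgliftB subrK.
Qed.

Let fgliftZ a D : fglift f' (a *: D) = a *: fglift f' D.
Proof.
rewrite -[D]freeg_sumE scaler_sumr !(big_morph _ fgliftD fglift0) scaler_sumr.
apply: eq_bigr => p _; set b := coeff _ _.
rewrite liftU scalerA -(liftU f'); congr fglift.
by apply/eqP/freeg_eqP => z; rewrite coeffZ !coeffU mulrA.
Qed.

Let fglift_rel D : tensor_rel D -> fglift f' D = 0.
Proof.
elim=> [|a D1 E _ hD _ hE|u u' w|u w w'|a u w|a u w] //.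
- by rewrite fgliftD fgliftZ hD hE scaler0 addr0.
- by rewrite !fgliftB !fgliftU /f' /= linearDl /= addrAC addrK subrr.
- by rewrite !fgliftB !fgliftU /f' /= linearDr /= addrAC addrK subrr.
- by rewrite !fgliftB fgliftZ !fgliftU /f' /= linearZl_LR subrr.
- by rewrite !fgliftB fgliftZ !fgliftU /f' /= linearZr_LR subrr.
Qed.

Let tlift_pi D : tlift (tpi D) = fglift f' D.
Proof.
by apply/eqP; rewrite -subr_eq0 -fgliftB; apply/eqP/fglift_rel/repr_tpi.
Qed.

Fact tlift_is_linear : linear tlift.
Proof.
move=> a x y; rewrite -[x]tpi_repr -[y]tpi_repr -linearP !tlift_pi.
by rewrite fgliftD fgliftZ.
Qed.
HB.instance Definition _ :=
  GRing.isLinear.Build F (U ⊗ W) M *:%R tlift tlift_is_linear.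

Lemma tliftE u w : tlift (u ⊗ₜ w) = f u w.
Proof. by rewrite /tens tlift_pi fgliftU. Qed.

End Lift.

Section TensorMap.
Variables (F : fieldType) (U U' W W' : lmodType F).
Variables (f : {linear U -> U'}) (g : {linear W -> W'}).

Let fg u w : U' ⊗ W' := f u ⊗ₜ g w.

Fact tmap_is_bilinear : bilinear_for *:%R *:%R fg.
Proof. by split=> [w a u v|u a v w]; rewrite /fg linearP /= ?linearPl ?linearPr. Qed.
HB.instance Definition _ :=
  bilinear_isBilinear.Build F U W (U' ⊗ W') *:%R *:%R fg tmap_is_bilinear.

Definition tmap : U ⊗ W -> U' ⊗ W' := tlift fg.
HB.instance Definition _ := GRing.Linear.on tmap.

Lemma tmapE u w : tmap (u ⊗ₜ w) = f u ⊗ₜ g w.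
Proof. exact: tliftE. Qed.

End TensorMap.

Section CanonicalMaps.
Variables (F : fieldType) (U V W : lmodType F).

Let swap (u : U) (v : V) : V ⊗ U := v ⊗ₜ u.

Fact tswap_is_bilinear : bilinear_for *:%R *:%R swap.
Proof. by split=> [w a u v|u a v w]; rewrite /swap ?linearPl ?linearPr. Qed.
HB.instance Definition _ :=
  bilinear_isBilinear.Build F U V (V ⊗ U) *:%R *:%R swap tswap_is_bilinear.

Definition tswap : U ⊗ V -> V ⊗ U := tlift swap.
HB.instance Definition _ := GRing.Linear.on tswap.

Lemma tswapE u v : tswap (u ⊗ₜ v) = v ⊗ₜ u.
Proof. exact: tliftE. Qed.

Let unitl (a : F^o) (v : V) : V := a *: v.

Fact tunitl_is_bilinear : bilinear_for *:%R *:%R unitl.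
Proof.
split=> [v a b c|b a v w]; rewrite /unitl; first by rewrite scalerDl -scalerA.
by rewrite scalerDr scalerA mulrC -scalerA.
Qed.
HB.instance Definition _ :=
  bilinear_isBilinear.Build F F^o V V *:%R *:%R unitl tunitl_is_bilinear.

Definition tunitl : F^o ⊗ V -> V := tlift unitl.
HB.instance Definition _ := GRing.Linear.on tunitl.

Lemma tunitlE a v : tunitl (a ⊗ₜ v) = a *: v.
Proof. exact: tliftE. Qed.

Let unitr (v : V) (a : F^o) : V := a *: v.

Fact tunitr_is_bilinear : bilinear_for *:%R *:%R unitr.
Proof.
by have [h1 h2] := tunitl_is_bilinear; split=> [a b v w|v b a c];
  [apply: h2 | apply: h1].
Qed.
HB.instance Definition _ :=
  bilinear_isBilinear.Build F V F^o V *:%R *:%R unitr tunitr_is_bilinear.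

Definition tunitr : V ⊗ F^o -> V := tlift unitr.
HB.instance Definition _ := GRing.Linear.on tunitr.

Lemma tunitrE v a : tunitr (v ⊗ₜ a) = a *: v.
Proof. exact: tliftE. Qed.

Section Fix.
Variable u : U.
Let assoc2 (v : V) (w : W) : (U ⊗ V) ⊗ W := (u ⊗ₜ v) ⊗ₜ w.

Fact tassoc2_is_bilinear : bilinear_for *:%R *:%R assoc2.
Proof.
by split=> [w a v v'|v a w w']; rewrite /assoc2 ?linearPr //= linearPl.
Qed.
HB.instance Definition _ :=
  bilinear_isBilinear.Build F V W ((U ⊗ V) ⊗ W) *:%R *:%R assoc2 tassoc2_is_bilinear.

Definition tassoc1 : V ⊗ W -> (U ⊗ V) ⊗ W := tlift assoc2.
HB.instance Definition _ := GRing.Linear.on tassoc1.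

Lemma tassoc1E v w : tassoc1 (v ⊗ₜ w) = (u ⊗ₜ v) ⊗ₜ w.
Proof. exact: tliftE. Qed.
End Fix.

Let assoc (u : U) (x : V ⊗ W) : (U ⊗ V) ⊗ W := tassoc1 u x.

Fact tassoc_is_bilinear : bilinear_for *:%R *:%R assoc.
Proof.
split=> [x a u u'|u a x y]; last by rewrite /assoc linearP.
rewrite /assoc; elim/tens_ind: x => [|v w x IHx].
  by rewrite !raddf0 /= scaler0 addr0.
rewrite !(raddfD (tassoc1 _)) /= IHx !tassoc1E linearPl /= linearPl /=.
by rewrite scalerDr addrACA.
Qed.
HB.instance Definition _ :=
  bilinear_isBilinear.Build F U (V ⊗ W) ((U ⊗ V) ⊗ W) *:%R *:%R assoc
    tassoc_is_bilinear.

Definition tassoc : U ⊗ (V ⊗ W) -> (U ⊗ V) ⊗ W := tlift assoc.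
HB.instance Definition _ := GRing.Linear.on tassoc.

Lemma tassocE u v w : tassoc (u ⊗ₜ (v ⊗ₜ w)) = (u ⊗ₜ v) ⊗ₜ w.
Proof. by rewrite [LHS]tliftE [LHS]tassoc1E. Qed.

End CanonicalMaps.

(* A series in [M[[x, x^-1]]] is the function [n |-> coefficient of x^n]; a
   linear map into [M[[x, x^-1]]] is a family of linear maps into [M]. *)
Definition fseries (M : Type) := int -> M.

Section FormalSeries.
Variables (F : fieldType) (M : lmodType F).
Implicit Type s : fseries M.

Definition fconst (m : M) : fseries M := fun n => if n == 0 then m else 0.

(* [x^m s(x)] *)
Definition fshift (m : int) s : fseries M := fun n => s (n - m).

Definition fres s : M := s (- 1).

Definition fderiv s : fseries M := fun n => (n + 1)%:~R *: s (n + 1).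

(* [s \in M((x^-1))] *)
Definition finitely_many_pos s := exists N : int, forall n, N < n -> s n = 0.

(* [s \in M[[x]]] *)
Definition nonneg_powers s := forall n, n < 0 -> s n = 0.

(* [lim_(x -> 0) s(x)], meaningful for [s \in M[[x]]] *)
Definition flim0 s : M := s 0.

End FormalSeries.

(* Series in [x0, x1, x2]: [s (e0, e1, e2)] is the coefficient of
   [x0^e0 x1^e1 x2^e2]. *)
Definition fseries3 (M : Type) := int * int * int -> M.

(* The sum is [0] by convention when infinitely many terms are nonzero; this
   does not occur for the three products of the Jacobi identity, see
   [jacobi_finite_support1], [jacobi_finite_support2] and
   [jacobi_finite_support3]. *)
Definition fmul3 (F : fieldType) (M : lmodType F) (d : fseries3 F)
    (s : fseries3 M) : fseries3 M :=
  fun e => \sum_(i \in [set: int * int * int]) d i *: s (e - i).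

Section Delta.
Variable F : fieldType.

Definition binomz (n : int) (k : nat) : F :=
  (\prod_(i < k) (n - i%:Z))%:~R / (k`!)%:R.

(* The coefficient of [y^i z^j] in [(y - z)^n], expanded in nonnegative powers
   of [z]. *)
Definition pow_sub (n i j : int) : F :=
  if j is Posz k then
    if i == n - k%:Z then (-1) ^+ k * binomz n k else 0
  else 0.

(* [x0^-1 delta((x1 - x2)/x0) = \sum_n x0^(-n-1) (x1 - x2)^n] *)
Definition delta012 : fseries3 F := fun e =>
  let: (e0, e1, e2) := e in pow_sub (- e0 - 1) e1 e2.

(* [x0^-1 delta((x2 - x1)/(-x0)) = \sum_n (-1)^n x0^(-n-1) (x2 - x1)^n] *)
Definition delta021 : fseries3 F := fun e =>
  let: (e0, e1, e2) := e in (-1) ^ (- e0 - 1) * pow_sub (- e0 - 1) e2 e1.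

(* [x2^-1 delta((x1 - x0)/x2) = \sum_n x2^(-n-1) (x1 - x0)^n] *)
Definition delta210 : fseries3 F := fun e =>
  let: (e0, e1, e2) := e in pow_sub (- e2 - 1) e1 e0.

End Delta.

Section VertexCoalgebra.
Variables (F : fieldType) (V : lmodType F).
Variables (Y : fseries {linear V -> V ⊗ V}) (c : {linear V -> F^o}).

Definition coprod (v : V) : fseries (V ⊗ V) := fun n => Y n v.

(* [(c ⊗ Id) Y(x) v] and [(Id ⊗ c) Y(x) v] *)
Definition counitl (v : V) : fseries V := fun n => tunitl (tmap c idfun (Y n v)).
Definition counitr (v : V) : fseries V := fun n => tunitr (tmap idfun c (Y n v)).

(* Iterated coproducts take values in [(V ⊗ V) ⊗ V], identified with
   [V ⊗ (V ⊗ V)] through [tassoc]. *)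

(* [(Id ⊗ Y(x2)) Y(x1) v] *)
Definition coprod_r21 (v : V) : fseries3 ((V ⊗ V) ⊗ V) := fun e =>
  let: (e0, e1, e2) := e in
  if e0 == 0 then tassoc (tmap idfun (Y e2) (Y e1 v)) else 0.

(* [(T ⊗ Id) (Id ⊗ Y(x1)) Y(x2) v] *)
Definition coprod_r12 (v : V) : fseries3 ((V ⊗ V) ⊗ V) := fun e =>
  let: (e0, e1, e2) := e in
  if e0 == 0 then
    tmap (@tswap F V V) idfun (tassoc (tmap idfun (Y e1) (Y e2 v)))
  else 0.

(* [(Y(x0) ⊗ Id) Y(x2) v] *)
Definition coprod_l02 (v : V) : fseries3 ((V ⊗ V) ⊗ V) := fun e =>
  let: (e0, e1, e2) := e in
  if e1 == 0 then tmap (Y e0) idfun (Y e2 v) else 0.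

Record is_vertex_coalgebra : Prop := IsVertexCoalgebra {
  vc_left_counit : forall v, counitl v =1 fconst v;
  vc_cocreation : forall v, nonneg_powers (counitr v) /\ flim0 (counitr v) = v;
  vc_truncation : forall v, finitely_many_pos (coprod v);
  vc_jacobi : forall v e,
    fmul3 (@delta012 F) (coprod_r21 v) e - fmul3 (@delta021 F) (coprod_r12 v) e
    = fmul3 (@delta210 F) (coprod_l02 v) e
}.

(* [Res_x x^-2 (Id ⊗ c) Y(x)] *)
Definition Dstar (v : V) : V := fres (fshift (- 2) (counitr v)).

Fact Dstar_is_linear : linear Dstar.
Proof. by move=> a u v; rewrite /Dstar /fres /fshift /counitr !linearP. Qed.
HB.instance Definition _ :=
  GRing.isLinear.Build F V V *:%R Dstar Dstar_is_linear.

Section FiniteSupport.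
Hypothesis truncY : forall v, finitely_many_pos (coprod v).
Variables (v : V) (e : int * int * int).

Lemma finite_set_ray (T : Type) (g : nat -> T) (n : int) (A : set T) :
  (forall i, A i -> exists2 k : nat, k%:Z <= n & i = g k) -> finite_set A.
Proof.
move=> hA; apply: (@sub_finite_set _ _ (g @` `I_(absz n).+1)); last first.
  exact/finite_image/finite_II.
move=> i /hA[k kn ->]; exists k => //=.
by rewrite ltnS -lez_nat; apply: (le_trans kn); rewrite abszE ler_norm.
Qed.

Lemma jacobi_finite_support1 :
  finite_set [set i | @delta012 F i *: coprod_r21 v (e - i) != 0].
Proof.
case: e => [[a b] d]; have [N hN] := truncY v.
apply: (@finite_set_ray _ (fun k => (a, - a - 1 - k%:Z, k%:Z)) (N - b - a - 1)).
move=> [[i j] [k|k]]; rewrite /= ?scale0r ?eqxx //.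
case: (eqVneq (a - i) 0) => [/subr0_eq <-|_]; last by rewrite scaler0 eqxx.
case: (eqVneq j (- a - 1 - k%:Z)) => [->|_]; last by rewrite scale0r eqxx.
case: (ltP N (b - (- a - 1 - k%:Z))) => [/hN|le_N _].
  by rewrite /coprod => ->; rewrite !raddf0 eqxx.
by exists k => //; lia.
Qed.

Lemma jacobi_finite_support2 :
  finite_set [set i | @delta021 F i *: coprod_r12 v (e - i) != 0].
Proof.
case: e => [[a b] d]; have [N hN] := truncY v.
apply: (@finite_set_ray _ (fun k => (a, k%:Z, - a - 1 - k%:Z)) (N - d - a - 1)).
move=> [[i [k|k]] j]; rewrite /= ?mulr0 ?scale0r ?eqxx //.
case: (eqVneq (a - i) 0) => [/subr0_eq <-|_]; last by rewrite scaler0 eqxx.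
case: (eqVneq j (- a - 1 - k%:Z)) => [->|_]; last by rewrite mulr0 scale0r eqxx.
case: (ltP N (d - (- a - 1 - k%:Z))) => [/hN|le_N _].
  by rewrite /coprod => ->; rewrite !raddf0 eqxx.
by exists k => //; lia.
Qed.

Lemma jacobi_finite_support3 :
  finite_set [set i | @delta210 F i *: coprod_l02 v (e - i) != 0].
Proof.
case: e => [[a b] d]; have [N hN] := truncY v.
apply: (@finite_set_ray _ (fun k => (k%:Z, b, - b - 1 - k%:Z)) (N - d - b - 1)).
move=> [[[k|k] j] i]; rewrite /= ?scale0r ?eqxx //.
case: (eqVneq (b - j) 0) => [/subr0_eq <-|_]; last by rewrite scaler0 eqxx.
case: (eqVneq b (- i - 1 - k%:Z)) => [hb|_]; last by rewrite scale0r eqxx.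
have -> : i = - b - 1 - k%:Z by lia.
case: (ltP N (d - (- b - 1 - k%:Z))) => [/hN|le_N _].
  by rewrite /coprod => ->; rewrite !raddf0 eqxx.
by exists k => //; lia.
Qed.

End FiniteSupport.

End VertexCoalgebra.

(* Main.v *)
Require Import Defs.
From HB Require Import structures.
From mathcomp Require Import all_boot all_order all_algebra.
From mathcomp Require Import classical_sets cardinality fsbigop.
From mathcomp Require Import zify.

Set Implicit Arguments.
Unset Strict Implicit.
Unset Printing Implicit Defensive.

Import GRing.Theory.
Local Open Scope ring_scope.

(** The formula is the image under [Id ⊗ Id ⊗ c] of one coefficient of the
    Jacobi identity, that of [x0^n x1^-1 x2^1]; it is dual to the computation of
    [(u_m w)_(-2) 1] in a vertex algebra by the associativity formula.  Write
    [Y_k] for the coefficient of [x^k] in [Y(x)].  Cocreation says that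
    [(Id ⊗ c) Y_k] is [0] for [k < 0] and [Id] for [k = 0], while for [k = 1] it
    is [D^*] by definition.

    - On the right, the coefficient of [x1^-1] in [x2^-1 delta((x1 - x0)/x2)] is
      [1], because [binom(k - 1, k) = 0] for [k > 0]; what remains is
      [(Y_n ⊗ Id) Y_1], which contracts to [Y_n D^*]
      ([contract_jacobi_rhs]).
    - The first product is the sum over [k >= 0] of
      [(-1)^k binom(-n - 1, k) (Id ⊗ Y_(1 - k)) Y_(n + k)].  Contraction kills
      [k >= 2]; [k = 0] gives [(Id ⊗ D^* ) Y_n] and [k = 1] gives
      [(n + 1) Y_(n + 1)], the coefficient of [x^n] in the derivative of [Y(x)]
      ([contract_jacobi_lhs1]).
    - In the second product the inner coproduct is always some [Y_(-1 - k)] with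
      [k >= 0], so its contraction vanishes ([contract_jacobi_lhs2]). *)

(** * Contracting the last tensor factor *)

Section Contraction.
Variables (F : fieldType) (V : lmodType F) (c : {linear V -> F^o}).

Definition contract (U : lmodType F) (x : U ⊗ V) : U := tunitr (tmap idfun c x).

Fact contract_is_linear (U : lmodType F) : linear (@contract U).
Proof. by move=> a x y; rewrite /contract !linearP. Qed.
HB.instance Definition _ (U : lmodType F) :=
  GRing.isLinear.Build F (U ⊗ V) U *:%R (@contract U) (@contract_is_linear U).

Lemma contractE (U : lmodType F) (u : U) (w : V) : contract (u ⊗ₜ w) = c w *: u.
Proof. by rewrite /contract tmapE tunitrE. Qed.

Lemma contract_tmapl (U U' : lmodType F) (g : {linear U -> U'}) (x : U ⊗ V) :
  contract (tmap g idfun x) = g (contract x).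
Proof.
elim/tens_ind: x => [|u w x IHx]; first by rewrite !raddf0.
by rewrite !raddfD /= IHx tmapE !contractE linearZ.
Qed.

(** For [f] a coefficient of the coproduct, this evaluates the contraction of an
    iterated coproduct [(Id ⊗ Y_k) Y_l] from that of [Y_k] alone. *)
Lemma contract_tassoc_tmap (U W W' : lmodType F) (f : {linear W -> W' ⊗ V})
    (h : {linear W -> W'}) (x : U ⊗ W) :
    (forall w, contract (f w) = h w) ->
  contract (tassoc (tmap idfun f x)) = tmap idfun h x.
Proof.
move=> fh; elim/tens_ind: x => [|u w x IHx]; first by rewrite !raddf0.
rewrite !raddfD /= IHx !tmapE -fh; congr (_ + _).
elim/tens_ind: (f w) => [|w' z y IHy]; first by rewrite linear0r !raddf0 linear0r.
rewrite linearDr !raddfD /= IHy tassocE !contractE linearDr /=.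
by rewrite linearZr_LR.
Qed.

Lemma tmap_idfun_idfun (U W : lmodType F) (x : U ⊗ W) : tmap idfun idfun x = x.
Proof.
elim/tens_ind: x => [|u w x IHx]; first by rewrite raddf0.
by rewrite raddfD /= IHx tmapE.
Qed.

Lemma tmap_idfun_null (U W W' : lmodType F) (x : U ⊗ W) :
  tmap idfun (\0 : W -> W') x = 0.
Proof.
elim/tens_ind: x => [|u w x IHx]; first by rewrite raddf0.
by rewrite raddfD /= IHx tmapE linear0r addr0.
Qed.

End Contraction.

(** * Coefficients of products of formal series *)

(** Finiteness of the support before applying [phi] has to be assumed: otherwise
    [fmul3 d s e] is [0] by convention, whereas [phi] may kill all but finitely
    many terms of the sum and leave a nonzero value. *)
Lemma linear_fmul3 (F : fieldType) (M N : lmodType F) (phi : {linear M -> N})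
    (d : fseries3 F) (s : fseries3 M) (e : int * int * int)
    (r : seq (int * int * int)) :
    finite_set [set i | d i *: s (e - i) != 0]%classic -> uniq r ->
    (forall i, i \notin r -> d i *: phi (s (e - i)) = 0) ->
  phi (fmul3 d s e) = \sum_(i <- r) d i *: phi (s (e - i)).
Proof.
move=> finA r_uniq r_supp; rewrite /fmul3.
set A := [set i | _]%classic in finA.
have suppA (N' : lmodType F) (f : {linear M -> N'}) :
    \sum_(i \in [set: int * int * int]%classic) f (d i *: s (e - i))
    = \sum_(i <- finmap.enum_fset (fset_set A)) f (d i *: s (e - i)).
  rewrite -fsbig_finite //; apply/esym/fsbig_widen => // i [_ /= nAi].
  suff -> : d i *: s (e - i) = 0 by rewrite raddf0.
  by apply/eqP; apply: contraT => /nAi.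
have := suppA _ idfun; rewrite /= => ->.
rewrite raddf_sum -suppA.
under eq_fsbigr do rewrite linearZ /=.
rewrite [RHS](bigfs _ r_uniq) //; last by move=> i _; apply: r_supp.
by apply: eq_fsbigl; apply/seteqP.
Qed.

(** * The binomial coefficients in the delta functions *)

Section Binomials.
Variable F : fieldType.

Lemma binomz0 (n : int) : binomz F n 0 = 1.
Proof. by rewrite /binomz big_ord0 fact0 divr1. Qed.

Lemma binomz1 (n : int) : binomz F n 1 = n%:~R.
Proof. by rewrite /binomz big_ord1 subr0 divr1. Qed.

Lemma binomz_small (n k : nat) : (n < k)%N -> binomz F n%:Z k = 0.
Proof.
by move=> lt_nk; rewrite /binomz (bigD1 (Ordinal lt_nk)) //= subrr mul0r mul0r.
Qed.

End Binomials.

(** * The contracted Jacobi identity *)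

Section ContractedJacobi.
Variables (F : fieldType) (V : lmodType F) (Y : fseries {linear V -> V ⊗ V}).
Variables (c : {linear V -> F^o}) (hV : is_vertex_coalgebra Y c).

Lemma contract_coprod_neg (n : int) (v : V) : n < 0 -> contract c (Y n v) = 0.
Proof. by move=> n_lt0; have [+ _] := vc_cocreation hV v; apply. Qed.

Lemma contract_coprod0 (v : V) : contract c (Y 0 v) = v.
Proof. by have [_] := vc_cocreation hV v. Qed.

Lemma contract_coprod1 (v : V) : contract c (Y 1 v) = Dstar Y c v.
Proof. by []. Qed.

(** The term of index [k] of [(x1 - x2)^(-n - 1)] sits at the exponents
    [(n, - n - 1 - k, k)]; the two listed in the proof are [k = 0] and [k = 1]. *)
Lemma contract_jacobi_lhs1 (v : V) (n : int) :
  contract c (fmul3 (@delta012 F) (coprod_r21 Y v) (n, - 1, 1))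
  = tmap idfun (Dstar Y c) (Y n v) + (n + 1)%:~R *: Y (n + 1) v.
Proof.
have fin := jacobi_finite_support1 (vc_truncation hV) v (n, -1, 1).
rewrite (linear_fmul3 (r := [:: (n, - n - 1, 0); (n, - n - 2, 1)]) fin) //.
- rewrite !big_cons big_nil /= !subrr /=; congr (_ + _).
    rewrite subr0 eqxx binomz0 expr0 mulr1 scale1r.
    have -> : -1 - (- n - 1) = n by lia.
    exact: contract_tassoc_tmap contract_coprod1.
  have -> : (- n - 2 == - n - 1 - 1) by lia.
  have -> : -1 - (- n - 2) = n + 1 by lia.
  rewrite addr0 binomz1 expr1 mulN1r -rmorphN /= opprB opprK [1 + n]addrC.
  rewrite (contract_tassoc_tmap (h := idfun) _ contract_coprod0).
  by rewrite tmap_idfun_idfun.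
- by rewrite /= inE; apply/andP; split=> //; apply/eqP; case=> _ /eqP; lia.
move=> [[i j] [k|k]] /=; last by rewrite scale0r.
case: (eqVneq (n - i) 0) => [/subr0_eq <-|_]; last by rewrite raddf0 scaler0.
case: (eqVneq j (- n - 1 - k%:Z)) => [->|_]; last by rewrite scale0r.
case: k => [|[|k]] nr.
- by rewrite subr0 !inE eqxx in nr.
- have E : - n - 1 - 1 = - n - 2 by lia.
  by rewrite E !inE eqxx orbT in nr.
rewrite (contract_tassoc_tmap (h := \0)); last first.
  by move=> w; apply: contract_coprod_neg; lia.
by rewrite tmap_idfun_null scaler0.
Qed.

(** This vanishing is the reason for the exponent [-1] of [x1]: here [x1] occurs
    in the delta function only with exponents [k >= 0], so the other factor
    must supply [x1^(-1 - k)], which cocreation excludes. *)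
Lemma contract_jacobi_lhs2 (v : V) (n : int) :
  contract c (fmul3 (@delta021 F) (coprod_r12 Y v) (n, - 1, 1)) = 0.
Proof.
have fin := jacobi_finite_support2 (vc_truncation hV) v (n, -1, 1).
rewrite (linear_fmul3 (r := [::]) fin) ?big_nil // => -[[i [k|k]] j] _ /=.
  case: (n - i == 0); last by rewrite raddf0 scaler0.
  rewrite contract_tmapl (contract_tassoc_tmap (h := \0)); last first.
    by move=> w; apply: contract_coprod_neg; lia.
  by rewrite tmap_idfun_null raddf0 scaler0.
by rewrite mulr0 scale0r.
Qed.

(** The exponent [1] of [x2] is chosen here: the only surviving term is [Y_n]
    applied to the left factor of [Y_1 v], whose contraction is [D^* v]. *)
Lemma contract_jacobi_rhs (v : V) (n : int) :
  contract c (fmul3 (@delta210 F) (coprod_l02 Y v) (n, - 1, 1))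
  = Y n (Dstar Y c v).
Proof.
have fin := jacobi_finite_support3 (vc_truncation hV) v (n, -1, 1).
rewrite (linear_fmul3 (r := [:: (0, -1, 0)]) fin) //.
  rewrite big_cons big_nil /= !subr0 binomz0 expr0 mulr1.
  by rewrite scale1r addr0 contract_tmapl contract_coprod1.
move=> [[[k|k] j] i] /=; last by rewrite scale0r.
case: (eqVneq (-1 - j) 0) => [/subr0_eq <-|_]; last by rewrite raddf0 scaler0.
case: (eqVneq (-1) (- i - 1 - k%:Z)) => [hi|_]; last by rewrite scale0r.
case: k hi => [|k] hi nr.
  have E : i = 0 by lia.
  by rewrite E !inE eqxx in nr.
(* The exponent of [x1 - x0] is then [k], below the index [k.+1]. *)
have -> : - i - 1 = k%:Z by lia.
by rewrite binomz_small // mulr0 scale0r.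
Qed.

End ContractedJacobi.

Theorem proposition2p4 (F : fieldType) (charF0 : [pchar F] =i pred0)
    (V : lmodType F) (Y : fseries {linear V -> V ⊗ V}) (c : {linear V -> F^o})
    (hV : is_vertex_coalgebra Y c) (v : V) :
  fderiv (coprod Y v)
  =1 (fun n => coprod Y (Dstar Y c v) n - tmap idfun (Dstar Y c) (coprod Y v n)).
Proof.
move=> n; rewrite /fderiv /coprod -(contract_jacobi_rhs hV).
rewrite -(vc_jacobi hV) raddfB /= contract_jacobi_lhs1 // contract_jacobi_lhs2 //.
by rewrite subr0 addrAC subrr add0r.
Qed.
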